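(* There is an absolute constant $C>0$ and a polynomial time algorithm that, on input a matrix $A\in\mathbb{R}^{m\times n}$ and an integer $k$ with $1\le k\le\min\{m,n\}$, outputs sets of indices $I\in\binom{[m]}{k}$ and $J\in\binom{[n]}{k}$ such that \[ k^{Ck}\cdot\lvert\det(A_{I,J})\rvert\;\geq\;\operatorname{maxdet}_k(A). \]
   Context: For a finite set $X$, $\binom{X}{k}$ denotes the family of $k$-element subsets of $X$, and $[n]=\{1,\dots,n\}$. For $I\subseteq[m]$, $J\subseteq[n]$, $A_{I,J}$ is the submatrix of $A$ with rows indexed by $I$ and columns indexed by $J$. The quantity $\operatorname{maxdet}_k(A)$ is defined as \[\operatorname{maxdet}_k(A)=\max\Big\{\lvert\det(A_{I,J})\rvert : I\in\tbinom{[m]}{k},\ J\in\tbinom{[n]}{k}\Big\},\] i.e. the largest absolute value of a $k\times k$ subdeterminant of $A$. (The paper writes the approximation factor as $k^{O(k)}$.) *)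

(* Defs.v *)
From HB Require Import structures.
From mathcomp Require Import all_boot all_order all_algebra.
From mathcomp Require Import all_classical all_reals all_analysis.

Set Implicit Arguments.
Unset Strict Implicit.
Unset Printing Implicit Defensive.

Import Order.TTheory GRing.Theory Num.Theory.

Local Open Scope ring_scope.

(* Subdeterminants.  Indices are 0-based: [m] is rendered as 'I_m. *)

Definition ksubset (m k : nat) := {I : {set 'I_m} | #|I| == k}.

(* enum_val lists a subset of 'I_m in increasing order. *)
Definition kelt (m k : nat) (I : ksubset m k) (i : 'I_k) : 'I_m :=
  enum_val (cast_ord (esym (eqP (valP I))) i).

Definition submatrix (R : realType) (m n k : nat) (A : 'M[R]_(m, n))
    (I : ksubset m k) (J : ksubset n k) : 'M[R]_k :=
  mxsub (kelt I) (kelt J) A.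

(* The default value 0 of the maximum is harmless: the family is nonempty when
   k <= minn m n, and its members are nonnegative. *)
Definition maxdet (R : realType) (m n k : nat) (A : 'M[R]_(m, n)) : R :=
  \big[Num.max/0]_(IJ : ksubset m k * ksubset n k)
    `|\det (submatrix A IJ.1 IJ.2)|.

(* Model of computation: a real RAM, programmed in a structured language.
   A program uses finitely many unbounded arrays of natural numbers and of
   reals, named by literals; a scalar variable is a cell with constant index.
   - Real cells are only manipulated through exact field operations and
     comparisons (as in the Blum-Shub-Smale model); there is no rounding
     and no conversion between reals and naturals, and 0 and 1 are the only
     real literals.
   - Naturals serve for control and indexing.  They have addition and truncated
     subtraction but no multiplication, so that in t unit-cost steps they stay
     below 2 ^ O(t).
   - Division by zero returns 0. *)

Inductive nexp :=
| NLit of nat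
| NGet of nat & nexp            (* array name, index *)
| NAdd of nexp & nexp
| NSub of nexp & nexp.

Inductive rexp :=
| RZero
| ROne
| RGet of nat & nexp            (* array name, index *)
| RAdd of rexp & rexp
| RSub of rexp & rexp
| RMul of rexp & rexp
| RDiv of rexp & rexp.

Inductive test :=
| TNLe of nexp & nexp
| TRLe of rexp & rexp
| TNot of test
| TAnd of test & test.

Inductive program :=
| Skip
| NSet of nat & nexp & nexp     (* array name, index, new value *)
| RSet of nat & nexp & rexp     (* array name, index, new value *)
| Seq of program & program
| If of test & program & program
| While of test & program.

Record state (R : realType) := State {
  narr : nat -> nat -> nat;     (* array name, index *)
  rarr : nat -> nat -> R
}.

Definition store (T : Type) (f : nat -> nat -> T) (x a : nat) (v : T) :
    nat -> nat -> T :=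
  fun y b => if (y == x) && (b == a) then v else f y b.

Fixpoint neval (R : realType) (s : state R) (e : nexp) : nat :=
  match e with
  | NLit c => c
  | NGet x a => narr s x (neval s a)
  | NAdd e1 e2 => (neval s e1 + neval s e2)%N
  | NSub e1 e2 => (neval s e1 - neval s e2)%N
  end.

Fixpoint reval (R : realType) (s : state R) (e : rexp) : R :=
  match e with
  | RZero => 0
  | ROne => 1
  | RGet x a => rarr s x (neval s a)
  | RAdd e1 e2 => reval s e1 + reval s e2
  | RSub e1 e2 => reval s e1 - reval s e2
  | RMul e1 e2 => reval s e1 * reval s e2
  | RDiv e1 e2 => reval s e1 / reval s e2
  end.

Fixpoint teval (R : realType) (s : state R) (b : test) : bool :=
  match b with
  | TNLe e1 e2 => (neval s e1 <= neval s e2)%N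
  | TRLe e1 e2 => reval s e1 <= reval s e2
  | TNot b1 => ~~ teval s b1
  | TAnd b1 b2 => teval s b1 && teval s b2
  end.

(* exec p s t s' : started in state s, the program p halts in state s' after t
   steps.  Each assignment and each evaluation of a test is one step; the
   expressions in it have a size fixed by the text of the program, so charging
   for every single operation would change t by a constant factor only. *)
Inductive exec (R : realType) :
    program -> state R -> nat -> state R -> Prop :=
| ExecSkip s : exec Skip s 1 s
| ExecNSet x a e s :
    exec (NSet x a e) s 1
      (State (store (narr s) x (neval s a) (neval s e)) (rarr s))
| ExecRSet x a e s :
    exec (RSet x a e) s 1
      (State (narr s) (store (rarr s) x (neval s a) (reval s e)))
| ExecSeq p q s1 s2 s3 t1 t2 :
    exec p s1 t1 s2 -> exec q s2 t2 s3 -> exec (Seq p q) s1 (t1 + t2)%N s3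
| ExecIfTrue b p q s s' t :
    teval s b -> exec p s t s' -> exec (If b p q) s t.+1 s'
| ExecIfFalse b p q s s' t :
    ~~ teval s b -> exec q s t s' -> exec (If b p q) s t.+1 s'
| ExecWhileFalse b p s :
    ~~ teval s b -> exec (While b p) s 1 s
| ExecWhileTrue b p s1 s2 s3 t1 t2 :
    teval s1 b -> exec p s1 t1 s2 -> exec (While b p) s2 t2 s3 ->
    exec (While b p) s1 (t1 + t2).+1 s3.

Lemma exec_det (R : realType) (p : program) (s s1 s2 : state R) (t1 t2 : nat) :
  exec p s t1 s1 -> exec p s t2 s2 -> t1 = t2 /\ s1 = s2.
Proof.
move=> e1; elim: e1 t2 s2 => {p s t1 s1}.
- by move=> s t2 s2 e2; inversion e2.
- by move=> x a e s t2 s2 e2; inversion e2.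
- by move=> x a e s t2 s2 e2; inversion e2.
- move=> p q s1 s2 s3 t1 t2 _ IHp _ IHq t s e2.
  inversion e2 as [| | |? ? ? ? ? ? ? ep eq| | | |]; subst.
  by case: (IHp _ _ ep) => ? ?; subst; case: (IHq _ _ eq) => ? ?; subst.
- move=> b p q s s' t bT _ IH t2 s2 e2.
  inversion e2 as [| | | |? ? ? ? ? ? b' e'|? ? ? ? ? ? b' e'| |]; subst.
    by case: (IH _ _ e') => -> ->.
  by rewrite bT in b'.
- move=> b p q s s' t bF _ IH t2 s2 e2.
  inversion e2 as [| | | |? ? ? ? ? ? b' e'|? ? ? ? ? ? b' e'| |]; subst.
    by rewrite b' in bF.
  by case: (IH _ _ e') => -> ->.
- move=> b p s bF t2 s2 e2.
  inversion e2 as [| | | | | |? ? ? b'|? ? ? ? ? ? ? b' ep ew]; subst => //.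
  by rewrite b' in bF.
- move=> b p s1 s2 s3 t1 t2 bT _ IH1 _ IH2 t s e2.
  inversion e2 as [| | | | | |? ? ? b'|? ? ? ? ? ? ? b' ep ew]; subst.
    by rewrite bT in b'.
  by case: (IH1 _ _ ep) => ? ?; subst; case: (IH2 _ _ ew) => ? ?; subst.
Qed.

(* Input: m, n, k in cells 0, 1, 2 of the array 0 of naturals, and A in row-major
   order in the array 0 of reals; all other cells hold 0. *)
Definition input (R : realType) (m n k : nat) (A : 'M[R]_(m, n)) : state R :=
  State
    (fun x a => if x == 0%N then nth 0%N [:: m; n; k] a else 0%N)
    (fun x a => if x == 0%N
                then nth 0 [seq A i j | i <- enum 'I_m, j <- enum 'I_n] a
                else 0).

(* The first k cells of the array x of naturals list the elements of I, each
   exactly once, in any order. *)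
Definition outputs (R : realType) (m k : nat) (s : state R) (x : nat)
    (I : ksubset m k) : Prop :=
  perm_eq (mkseq (narr s x) k) [seq val i | i <- enum (val I)].

(* Main.v *)
Require Import Defs.
From mathcomp Require Import all_boot all_order all_algebra.
From mathcomp Require Import all_classical all_reals all_analysis.
From mathcomp Require Import perm zify ring lra.
Import Order.TTheory GRing.Theory Num.Theory.
Local Open Scope ring_scope.

Set Implicit Arguments.
Unset Strict Implicit.
Unset Printing Implicit Defensive.

(* The algorithm is k steps of Gaussian elimination with complete pivoting.  Let
   p = W r c be an entry of W of maximal absolute value and W' the matrix left
   after pivoting on it.  Every entry of W' is at most 2 |p|, and W is W' plus a
   matrix of rank one with entries at most |p|; expanding a determinant of order
   q accordingly gives maxdet_q W <= 2 q (q + 1) |p| maxdet_(q-1) W'.  The product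
   of the k pivots is the absolute value of the subdeterminant found, so the loss
   is at most the product of the factors 2 q (q + 1) for 2 <= q <= k, hence at
   most k ^ (4 k); the step q = 1 is exact. *)

(** * Determinants, Schur complements and growth of minors under pivoting *)

(** Right multiplication by a block unitriangular matrix [X] clears the first row behind the pivot;
    what remains is block lower triangular with the Schur complement as its second block. *)
Lemma det_schur1 (F : fieldType) (q : nat) (B : 'M[F]_q.+1) :
  B ord0 ord0 != 0 ->
  \det B = B ord0 ord0 *
    \det (\matrix_(i < q, j < q)
      (B (lift ord0 i) (lift ord0 j)
       - B (lift ord0 i) ord0 / B ord0 ord0 * B ord0 (lift ord0 j))).
Proof.
move=> p0; pose p := B ord0 ord0.
pose B1 : 'M[F]_(1 + q) := B.
pose X : 'M[F]_(1 + q) := block_mx 1%:M (- p^-1 *: ursubmx B1) 0 1%:M.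
have -> : \det B = \det (B1 *m X).
  by rewrite det_mulmx det_ublock !det1 !mulr1.
have ulE : ulsubmx B1 = p%:M.
  by apply/matrixP=> i j; rewrite !mxE !ord1 eqxx; congr (B _ _); apply/val_inj.
rewrite -[B1 in \det (B1 *m _)]submxK mulmx_block !mulmx1 !mulmx0 !addr0.
rewrite ulE -scalemxAr mul_scalar_mx scalerA mulNr mulVf // scaleN1r addNr.
rewrite det_lblock det_scalar1; congr (_ * \det _).
apply/matrixP=> i j; rewrite !mxE big_ord1 !mxE addrC -!rshift1.
have -> : lshift q (0 : 'I_1) = ord0 by apply/val_inj.
by rewrite /B1 /p mulNr mulrN mulrA.
Qed.

Lemma norm_det_le_row (F : realFieldType) (q : nat) (B : 'M[F]_q.+1)
    (i : 'I_q.+1) (b M : F) :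
  (forall j, `|B i j| <= b) ->
  (forall j, `|\det (row' i (col' j B))| <= M) ->
  `|\det B| <= q.+1%:R * (b * M).
Proof.
move=> hb hM; rewrite (expand_det_row B i) (le_trans (ler_norm_sum _ _ _)) //.
have -> : q.+1%:R * (b * M) = \sum_(j < q.+1) b * M.
  by rewrite sumr_const card_ord mulr_natl.
apply: ler_sum => j _; rewrite normrM /cofactor normrM normrX normrN1 expr1n.
by rewrite mul1r ler_pM ?hb ?hM.
Qed.

Lemma norm_det_le_col (F : realFieldType) (q : nat) (B : 'M[F]_q.+1)
    (j : 'I_q.+1) (b M : F) :
  (forall i, `|B i j| <= b) ->
  (forall i, `|\det (row' i (col' j B))| <= M) ->
  `|\det B| <= q.+1%:R * (b * M).
Proof.
move=> hb hM; rewrite -det_tr; apply: (@norm_det_le_row _ _ _ j) => i.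
  by rewrite mxE.
have -> : row' j (col' i B^T) = (row' i (col' j B))^T.
  by apply/matrixP=> i1 j1; rewrite !mxE.
by rewrite det_tr.
Qed.

Definition minor (F : Type) (q : nat) (W : nat -> nat -> F) (f g : nat -> nat) :
    'M[F]_q := \matrix_(i < q, j < q) W (f i) (g j).

(** The index maps need be neither monotone nor injective: a repeated index gives determinant 0, so
    the wider range costs nothing and spares side conditions when maps are composed. *)
Definition minor_bound (F : realFieldType) (m n : nat) (W : nat -> nat -> F)
    (q : nat) (M : F) : Prop :=
  forall f g : nat -> nat,
    (forall t, (t < q)%N -> (f t < m)%N) ->
    (forall t, (t < q)%N -> (g t < n)%N) ->
    `|\det (minor q W f g)| <= M.

(** The matrix keeps its size, so indices never shift: row [r] and column [c] become zero when
    [W r c] is nonzero. When [W r c] is 0, division by zero gives back [W]. *)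
Definition pivot (F : fieldType) (W : nat -> nat -> F) (r c i j : nat) : F :=
  W i j - W i c / W r c * W r j.

Lemma det_minor_pivot (F : fieldType) (q : nat) (W : nat -> nat -> F)
    (f g : nat -> nat) :
  W (f 0%N) (g 0%N) != 0 ->
  \det (minor q.+1 W f g) =
  W (f 0%N) (g 0%N) *
    \det (minor q (pivot W (f 0%N) (g 0%N)) (f \o succn) (g \o succn)).
Proof.
move=> p0; rewrite det_schur1 !mxE //; congr (_ * \det _).
by apply/matrixP=> i j; rewrite !mxE.
Qed.

Lemma norm_pivot_le (F : realFieldType) (m n : nat) (W : nat -> nat -> F)
    (r c i j : nat) :
  (r < m)%N -> (c < n)%N -> (i < m)%N -> (j < n)%N ->
  (forall i j, (i < m)%N -> (j < n)%N -> `|W i j| <= `|W r c|) ->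
  `|pivot W r c i j| <= `|W r c| *+ 2.
Proof.
move=> hr hc hi hj hW; rewrite /pivot (le_trans (ler_normB _ _)) // mulr2n.
apply: lerD; first exact: hW.
have [->|p0] := eqVneq (W r c) 0; first by rewrite invr0 mulr0 mul0r normr0.
rewrite 2!normrM normfV mulrAC ler_pdivrMr ?normr_gt0 //.
by rewrite ler_pM // hW.
Qed.

(* With p = W r c and W' = pivot W r c, a minor det W_{f,g} times p is the
   determinant of W'_{f,g} bordered by the row (p, - W r g) and the column
   (p, W f c); expanding it along both borders leaves minors of W'. *)
Lemma minor_bound_pivot (F : realFieldType) (m n : nat) (W : nat -> nat -> F)
    (r c q : nat) (M : F) :
  (r < m)%N -> (c < n)%N ->
  (forall i j, (i < m)%N -> (j < n)%N -> `|W i j| <= `|W r c|) ->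
  minor_bound m n (pivot W r c) q M ->
  minor_bound m n W q.+1 ((2 * q.+1 * q.+2)%:R * (`|W r c| * M)).
Proof.
move=> hr hc hW hM f g hf hg; set p := W r c.
have M0 : 0 <= M.
  apply: le_trans (hM (fun=> r) (fun=> c) _ _) => //.
(* A zero pivot of maximal absolute value forces all of [W] to vanish, so the minor is 0. *)
have [p0|p0] := eqVneq p 0.
  have -> : minor q.+1 W f g = 0.
    apply/matrixP=> i j; rewrite !mxE; apply/eqP.
    by rewrite -normr_le0 (le_trans (hW _ _ _ _)) ?hf ?hg // -/p p0 normr0.
  by rewrite det0 normr0 mulr_ge0 // mulr_ge0.
pose B : 'M[F]_q.+2 := \matrix_(i, j)
  match unlift ord0 i, unlift ord0 j with
  | None, None => p
  | None, Some j' => - W r (g j')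
  | Some i', None => W (f i') c
  | Some i', Some j' => pivot W r c (f i') (g j')
  end.
have B00 : B ord0 ord0 = p by rewrite mxE unlift_none.
have BE : \det B = p * \det (minor q.+1 W f g).
  rewrite det_schur1 B00 //; congr (_ * \det _).
  apply/matrixP=> i j; rewrite !mxE !liftK unlift_none /pivot -/p.
  by rewrite mulrN opprK subrK.
(* The factor q+2 comes from the border row, with entries at most |p|. The factor q+1 comes from the
   first column left, which is the border column, or a column of W' if that border was removed; its
   entries are at most 2 |p|. One |p| cancels at the end. *)
have : `|\det B| <= q.+2%:R * (`|p| * (q.+1%:R * (`|p| *+ 2 * M))).
  apply: (@norm_det_le_row _ _ _ ord0) => j.
    rewrite mxE unlift_none; case: unliftP => [j' _|_] //.
    by rewrite normrN hW // hg.
  apply: (@norm_det_le_col _ _ _ ord0) => i.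
    rewrite !mxE liftK; case: unliftP => [j' _|_].
      by rewrite (@norm_pivot_le _ m n) // ?hf ?hg.
    by rewrite (le_trans (hW _ _ _ _)) ?hf // mulr2n lerDl.
  (* Columns of W' left after two deletions: if the border went first (j = 0), then column 0 of W'
     goes; otherwise column j - 1 of W' goes and then the border. *)
  pose col b := if j == 0%N :> nat then b.+1 else bump j.-1 b.
  have colq b : (b < q)%N -> (col b < q.+1)%N.
    by rewrite /col /bump; case: ifP; lia.
  have -> : row' i (col' ord0 (row' ord0 (col' j B))) =
            minor q (pivot W r c) (f \o bump i) (g \o col).
    apply/matrixP=> a b; rewrite !mxE liftK.
    have -> : lift j (lift ord0 b) = lift ord0 (Ordinal (colq b (ltn_ord b))).
      by apply/val_inj; rewrite /= /col /bump; case: ifP; lia.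
    by rewrite liftK.
  apply: hM => t tq /=.
    by apply: hf; rewrite /bump; lia.
  exact/hg/colq.
rewrite BE normrM -ler_pdivlMl ?normr_gt0 // => /le_trans; apply.
rewrite -[X in _ <= X](mulKf (x := `|p|)) ?normr_eq0 //.
rewrite le_eqVlt; apply/orP; left; apply/eqP; congr (_ * _).
by rewrite !natrM -mulr_natl; ring.
Qed.

Lemma minor_bound_pivot0 (F : realFieldType) (m n : nat) (W : nat -> nat -> F)
    (r c : nat) :
  (forall i j, (i < m)%N -> (j < n)%N -> `|W i j| <= `|W r c|) ->
  minor_bound m n W 1 `|W r c|.
Proof. by move=> hW f g hf hg; rewrite det_mx11 mxE hW ?hf ?hg. Qed.

(** * Rules for total correctness with a time bound *)

(** The time is only bounded above, so that branches of different lengths can share one bound. *)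
Definition run (R : realType) (p : program) (t : nat) (s : state R)
    (Q : state R -> Prop) : Prop :=
  exists t' s', [/\ exec p s t' s', (t' <= t)%N & Q s'].

Definition nset (R : realType) (s : state R) (x a v : nat) : state R :=
  State (store (narr s) x a v) (rarr s).

Definition rset (R : realType) (s : state R) (x a : nat) (v : R) : state R :=
  State (narr s) (store (rarr s) x a v).

Lemma run_weaken (R : realType) (p : program) (t t' : nat) (s : state R)
    (Q Q' : state R -> Prop) :
  (t <= t')%N -> (forall s', Q s' -> Q' s') -> run p t s Q -> run p t' s Q'.
Proof.
move=> tt' QQ' [u [s' [e ut q]]]; exists u, s'; split => //.
  exact: leq_trans tt'.
exact: QQ'.
Qed.

Lemma run_leq (R : realType) (p : program) (t t' : nat) (s : state R)
    (Q : state R -> Prop) :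
  (t <= t')%N -> run p t s Q -> run p t' s Q.
Proof. by move=> tt'; apply: run_weaken. Qed.

Lemma run_skip (R : realType) (s : state R) (Q : state R -> Prop) :
  Q s -> run Skip 1 s Q.
Proof. by move=> q; exists 1%N, s; split => //; constructor. Qed.

Lemma run_nset (R : realType) (x : nat) (a e : nexp) (s : state R)
    (Q : state R -> Prop) :
  Q (nset s x (neval s a) (neval s e)) -> run (NSet x a e) 1 s Q.
Proof. by move=> q; eexists 1%N, _; split; [constructor | | exact: q]. Qed.

Lemma run_rset (R : realType) (x : nat) (a : nexp) (e : rexp) (s : state R)
    (Q : state R -> Prop) :
  Q (rset s x (neval s a) (reval s e)) -> run (RSet x a e) 1 s Q.
Proof. by move=> q; eexists 1%N, _; split; [constructor | | exact: q]. Qed.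

Lemma run_seq (R : realType) (p q : program) (t u : nat) (s : state R)
    (Q : state R -> Prop) :
  run p t s (fun s' => run q u s' Q) -> run (Seq p q) (t + u) s Q.
Proof.
move=> [t1 [s1 [e1 l1 [t2 [s2 [e2 l2 q2]]]]]].
exists (t1 + t2)%N, s2; split => //; last exact: leq_add.
exact: ExecSeq e1 e2.
Qed.

Lemma run_if (R : realType) (b : test) (p q : program) (t : nat) (s : state R)
    (Q : state R -> Prop) :
  (teval s b -> run p t s Q) -> (~~ teval s b -> run q t s Q) ->
  run (If b p q) t.+1 s Q.
Proof.
move=> hp hq; case: (boolP (teval s b)) => hb.
  by have [u [s' [e l q']]] := hp hb; exists u.+1, s'; split => //; exact: ExecIfTrue.
by have [u [s' [e l q']]] := hq hb; exists u.+1, s'; split => //; exact: ExecIfFalse.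
Qed.

Definition nvar (x : nat) : nexp := NGet x (NLit 0).

Definition for_loop (x : nat) (b : nexp) (p : program) : program :=
  Seq (NSet x (NLit 0) (NLit 0))
      (While (TNLe (NAdd (nvar x) (NLit 1)) b)
             (Seq p (NSet x (NLit 0) (NAdd (nvar x) (NLit 1))))).

(** Each round costs t for the body, one step for the test and one for the increment; the last 2
    pays for the initialization and the failing test. The invariant is required after the counter
    has been advanced. *)
Lemma run_for (R : realType) (x : nat) (b : nexp) (p : program) (N t : nat)
    (Inv : nat -> state R -> Prop) (s : state R) (Q : state R -> Prop) :
  (forall i s, Inv i s -> neval s b = N) ->
  Inv 0%N (nset s x 0 0) ->
  (forall i s, (i < N)%N -> narr s x 0 = i -> Inv i s ->
     run p t s (fun s' => narr s' x 0 = i /\ Inv i.+1 (nset s' x 0 i.+1))) ->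
  (forall s', Inv N s' -> Q s') ->
  run (for_loop x b p) (N * (t + 2) + 2) s Q.
Proof.
move=> hb h0 hS hQ; rewrite [X in run _ X]addnC -[2%N]/(1 + 1)%N -addnA.
apply: run_seq; apply: run_nset => /=.
set w := While _ _.
(* Induction on the number [d] of rounds still to run. *)
suff loop d i s' : d = (N - i)%N -> Inv i s' -> (i <= N)%N ->
    narr s' x 0 = i -> run w ((N - i) * (t + 2) + 1) s' Q.
  have := loop _ 0%N _ erefl h0 isT; rewrite subn0 addnC; apply.
  by rewrite /= /store !eqxx.
elim: d => [|d IH] in i s' *; move=> dE hI iN xi.
  have iE : i = N by lia.
  exists 1%N, s'; split; last by apply: hQ; rewrite -iE.
    by apply: ExecWhileFalse; rewrite /= xi (hb _ _ hI) iE -ltnNge addn1.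
  by lia.
have iN' : (i < N)%N by lia.
have [t1 [s1 [e1 l1 [x1 I1]]]] := hS _ _ iN' xi hI.
have x2 : narr (nset s1 x 0 i.+1) x 0 = i.+1 by rewrite /= /store !eqxx.
have [t2 [s2 [e2 l2 q2]]] := IH i.+1 _ ltac:(lia) I1 iN' x2.
exists ((t1 + 1) + t2).+1, s2; split => //.
  apply: ExecWhileTrue e2; first by rewrite /= xi (hb _ _ hI) addn1.
  apply: ExecSeq e1 _.
  have -> : i.+1 = neval s1 (NAdd (nvar x) (NLit 1)) by rewrite /= x1 addn1.
  exact: ExecNSet.
have -> : (N - i = (N - i.+1).+1)%N by lia.
by rewrite mulSn; lia.
Qed.

(** * Sweeps over a matrix stored in row-major order *)

Lemma row_major_inj (n i j i' j' : nat) :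
  (j < n)%N -> (j' < n)%N -> (i * n + j = i' * n + j')%N -> i = i' /\ j = j'.
Proof.
move=> hj hj' e; have n0 : (0 < n)%N by apply: leq_ltn_trans hj.
split.
  by have := congr1 (divn^~ n) e; rewrite !divnMDl // !divn_small // !addn0.
by have := congr1 (modn^~ n) e; rewrite !modnMDl !modn_small.
Qed.

Lemma row_major_lt (m n i j : nat) :
  (i < m)%N -> (j < n)%N -> (i * n + j < m * n)%N.
Proof. by move=> hi hj; have := leq_mul hi (leqnn n); rewrite mulSn; lia. Qed.

(* Layout of the memory.  Arrays of naturals: 0 the input (m, n, k); 1, 2 the
   pivot rows and columns found so far; 3, 4 flags marking them; 5 the number of
   pivots found so far; 6, 7, 8 the position i, j and i * n + j of a sweep over
   the matrix; 9, 10 the row and column of the current pivot.  Arrays of reals: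
   0 the current matrix; 1, 2 the pivot column divided by the pivot and the pivot
   row; 3, 4 the square of the current pivot and the current pivot. *)
Definition sweep (p : program) : program :=
  Seq (NSet 8 (NLit 0) (NLit 0))
      (for_loop 6 (nvar 0)
        (for_loop 7 (NGet 0 (NLit 1))
          (Seq p (NSet 8 (NLit 0) (NAdd (nvar 8) (NLit 1)))))).

(** The language has no multiplication of naturals, so cell 8 tracks the offset by increments. The
    invariant counts visited entries and must survive writes to the three counters, which settles
    the loop bookkeeping once for all sweeps. *)
Lemma run_sweep (R : realType) (m n : nat) (p : program) (t : nat)
    (Inv : nat -> state R -> Prop) (s : state R) (Q : state R -> Prop) :
  (forall e s, Inv e s -> narr s 0 0 = m /\ narr s 0 1 = n) ->
  (forall e s x v, x \in [:: 6; 7; 8]%N -> Inv e s -> Inv e (nset s x 0 v)) ->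
  Inv 0%N s ->
  (forall i j s, (i < m)%N -> (j < n)%N ->
     narr s 6 0 = i -> narr s 7 0 = j -> narr s 8 0 = (i * n + j)%N ->
     Inv (i * n + j)%N s ->
     run p t s (fun s' =>
       (forall x, x \in [:: 6; 7; 8]%N -> narr s' x 0 = narr s x 0) /\
       Inv (i * n + j).+1 s')) ->
  (forall s', Inv (m * n)%N s' -> Q s') ->
  run (sweep p) (m * (n * (t + 3) + 4) + 3) s Q.
Proof.
move=> hdim hst h0 hS hQ.
apply: (@run_leq _ _ (1 + (m * ((n * (t + 1 + 2) + 2) + 2) + 2))).
  by rewrite -!addnA; lia.
apply: run_seq; apply: run_nset => /=.
pose J i s := Inv (i * n)%N s /\ narr s 8 0 = (i * n)%N.
apply: (@run_for _ _ _ _ m _ J) => [i s' [/hdim[]]//| | |s' []]; last 2 first.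
- move=> i s1 iM si [hI s8].
  pose K j (s : state R) :=
    [/\ Inv (i * n + j)%N s, narr s 8 0 = (i * n + j)%N & narr s 6 0 = i].
  apply: (@run_for _ _ _ _ n _ K) => [j s' [/hdim[]]//| | |s' [h1 h2 h3]].
  + by split; rewrite ?addn0 //; apply: hst.
  + move=> j s2 jn s7 [hj s8' s6].
    apply: run_seq; apply: run_weaken (hS i j s2 iM jn s6 s7 s8' hj) => //.
    move=> s' [hx hI']; apply: run_nset => /=; split.
      by rewrite /store /= hx.
    rewrite /K /= /store /= !hx //= s8' addn1 addnS; split => //.
    apply: (hst _ _ 7%N) => //.
    exact: (hst _ _ 8%N).
  + split; first by [].
    split; last by rewrite /= /store /= h2 mulSn addnC.
    by apply: hst => //; rewrite mulSn addnC.
- by move=> h _; exact: hQ.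
- split => //=; rewrite mul0n.
  by apply: (hst) => //; apply: hst.
Qed.

(** * The three passes of a pivot step: search, copy, update *)

(** Frame condition: [xs] and [ys] name the arrays of naturals and of reals that may have
    changed. *)
Definition agree (R : realType) (xs ys : seq nat) (s s' : state R) : Prop :=
  (forall x a, x \notin xs -> narr s' x a = narr s x a) /\
  (forall y a, y \notin ys -> rarr s' y a = rarr s y a).

Lemma agree_refl (R : realType) (xs ys : seq nat) (s : state R) :
  agree xs ys s s.
Proof. by []. Qed.

Lemma agree_nset (R : realType) (xs ys : seq nat) (s s' : state R)
    (x a v : nat) :
  x \in xs -> agree xs ys s s' -> agree xs ys s (nset s' x a v).
Proof.
move=> hx [h1 h2]; split => // y b hy /=; rewrite /store.
by case: eqVneq => [yx|_] /=; [rewrite yx hx in hy | rewrite h1].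
Qed.

Lemma agree_rset (R : realType) (xs ys : seq nat) (s s' : state R)
    (y a : nat) (v : R) :
  y \in ys -> agree xs ys s s' -> agree xs ys s (rset s' y a v).
Proof.
move=> hy [h1 h2]; split => // x b hx /=; rewrite /store.
by case: eqVneq => [xy|_] /=; [rewrite xy hy in hx | rewrite h2].
Qed.

(** Only unflagged rows and columns are candidates. Comparing squares compares absolute values. *)
Definition search_step : program :=
  If (TAnd (TNLe (NGet 3 (nvar 6)) (NLit 0))
       (TAnd (TNLe (NGet 4 (nvar 7)) (NLit 0))
         (TNot (TRLe (RMul (RGet 0 (nvar 8)) (RGet 0 (nvar 8)))
                     (RGet 3 (NLit 0))))))
     (Seq (NSet 9 (NLit 0) (nvar 6))
     (Seq (NSet 10 (NLit 0) (nvar 7))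
     (Seq (RSet 4 (NLit 0) (RGet 0 (nvar 8)))
          (RSet 3 (NLit 0) (RMul (RGet 0 (nvar 8)) (RGet 0 (nvar 8)))))))
     Skip.

(* The initial value - 1 of the square makes the first free entry a candidate
   even if it is 0. *)
Definition search : program :=
  Seq (RSet 3 (NLit 0) (RSub RZero ROne)) (sweep search_step).

Lemma run_search (R : realType) (m n : nat) (s : state R)
    (Q : state R -> Prop) :
  let W i j := rarr s 0 (i * n + j)%N in
  let free i j :=
    [&& (i < m)%N, (j < n)%N, narr s 3 i == 0%N & narr s 4 j == 0%N] in
  narr s 0 0 = m -> narr s 0 1 = n -> (exists i j, free i j) ->
  (forall s' r c, agree [:: 6; 7; 8; 9; 10]%N [:: 3; 4]%N s s' ->
     narr s' 9 0 = r -> narr s' 10 0 = c -> free r c -> rarr s' 4 0 = W r c ->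
     (forall i j, free i j -> `|W i j| <= `|W r c|) -> Q s') ->
  run search (m * (n * 8 + 4) + 4) s Q.
Proof.
move=> W free sm sn [i0 [j0 f0]] hQ.
apply: (@run_leq _ _ (1 + (m * (n * (5 + 3) + 4) + 3))).
  by lia.
apply: run_seq; apply: run_rset => /=.
(* The value -1 stands for no free entry met so far. *)
pose Inv e s' :=
  [/\ agree [:: 6; 7; 8; 9; 10]%N [:: 3; 4]%N s s',
      rarr s' 3 0 = -1 \/
      [/\ free (narr s' 9 0) (narr s' 10 0),
          rarr s' 4 0 = W (narr s' 9 0) (narr s' 10 0) &
          rarr s' 3 0 = W (narr s' 9 0) (narr s' 10 0) ^+ 2] &
      forall i j, free i j -> (i * n + j < e)%N -> W i j ^+ 2 <= rarr s' 3 0].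
apply: (@run_sweep _ m n _ _ Inv).
- by move=> e s' [[h1 h2] _ _]; rewrite !h1.
- move=> e s' x v hx [h1 h2 h3]; split => //.
    apply: agree_nset => //; move: hx; rewrite !inE.
    by case/or3P => /eqP ->.
  by move: hx; rewrite !inE; case/or3P => /eqP ->.
- split => //=.
  + exact: agree_rset (agree_refl _ _ _).
  + by left; rewrite /store /= sub0r.
- move=> i j s' im jn s6 s7 s8 [ha hb hc].
  have sW a : rarr s' 0 a = rarr s 0 a by case: ha => _ ->.
  have s3 a : narr s' 3 a = narr s 3 a by case: ha => ->.
  have s4 a : narr s' 4 a = narr s 4 a by case: ha => ->.
  have split_lt i' j' : free i' j' -> (i' * n + j' < (i * n + j).+1)%N ->
      (i' * n + j' < i * n + j)%N \/ (i' = i /\ j' = j).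
    move=> /and4P[_ j'n _ _]; rewrite ltnS leq_eqVlt => /orP[/eqP|]; last by left.
    by move=> /(row_major_inj j'n jn); right.
  apply: run_if => /=; rewrite s6 s7 s8 s3 s4 sW !leqn0.
    case/and3P => f3 f4; rewrite -ltNge -expr2 => lt.
    have fij : free i j by rewrite /free im jn f3 f4.
    rewrite -[4%N]/(1 + (1 + (1 + 1)))%N.
    apply: run_seq; apply: run_nset; apply: run_seq; apply: run_nset.
    apply: run_seq; apply: run_rset; apply: run_rset => /=.
    rewrite /store /= s6 s7 s8 sW; split.
      by move=> x; rewrite !inE; case/or3P => /eqP ->.
    split => /=.
    + by apply: agree_rset => //; apply: agree_rset => //; do 2 apply: agree_nset => //.
    + by right; rewrite /store /= expr2.
    + move=> i' j' f' /(split_lt _ _ f')[l|[-> ->]]; rewrite /store /= -?expr2 //.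
      exact: le_trans (hc _ _ f' l) (ltW lt).
  move=> nt; apply: (@run_leq _ _ 1) => //; apply: run_skip.
  split => //; split => // i' j' f' /(split_lt _ _ f')[l|[e1 e2]]; first exact: hc.
  move: f' nt; rewrite e1 e2 /free => /and4P[_ _ -> ->] /=.
  by rewrite negbK expr2.
- move=> s' [ha hb hc].
  have := hc _ _ f0; case/and4P: (f0) => im jn _ _.
  move/(_ (row_major_lt im jn)) => h0.
  (* The free entry (i0, j0) has been visited and its square is nonnegative, so -1 cannot have
     survived. *)
  case: hb => [b1|[b1 b2 b3]].
    by have := sqr_ge0 (W i0 j0); rewrite b1 in h0; lra.
  apply: hQ ha erefl erefl b1 b2 _ => i j fij.
  rewrite -ler_sqr ?nnegrE // !real_normK ?num_real // -b3.
  by apply: hc => //; case/and4P: fij => *; apply: row_major_lt.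
Qed.

(** The update works in place and overwrites the pivot row and column while later entries still
    depend on them; hence they are saved first. Equality of naturals is tested by two
    inequalities. *)
Definition copy_step : program :=
  Seq (If (TAnd (TNLe (nvar 7) (nvar 10)) (TNLe (nvar 10) (nvar 7)))
          (RSet 1 (nvar 6) (RDiv (RGet 0 (nvar 8)) (RGet 4 (NLit 0)))) Skip)
      (If (TAnd (TNLe (nvar 6) (nvar 9)) (TNLe (nvar 9) (nvar 6)))
          (RSet 2 (nvar 7) (RGet 0 (nvar 8))) Skip).

Lemma run_copy (R : realType) (m n r c : nat) (s : state R)
    (Q : state R -> Prop) :
  let W i j := rarr s 0 (i * n + j)%N in
  narr s 0 0 = m -> narr s 0 1 = n -> narr s 9 0 = r -> narr s 10 0 = c ->
  (r < m)%N -> (c < n)%N ->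
  (forall s', agree [:: 6; 7; 8]%N [:: 1; 2]%N s s' ->
     (forall i, (i < m)%N -> rarr s' 1 i = W i c / rarr s 4 0) ->
     (forall j, (j < n)%N -> rarr s' 2 j = W r j) -> Q s') ->
  run (sweep copy_step) (m * (n * 7 + 4) + 3) s Q.
Proof.
move=> W sm sn sr sc rm cn hQ; rewrite -[7%N]/(4 + 3)%N.
pose Inv e s' :=
  [/\ agree [:: 6; 7; 8]%N [:: 1; 2]%N s s',
      forall i, (i < m)%N -> (i * n + c < e)%N ->
        rarr s' 1 i = W i c / rarr s 4 0 &
      forall j, (j < n)%N -> (r * n + j < e)%N -> rarr s' 2 j = W r j].
apply: (@run_sweep _ m n _ _ Inv).
- by move=> e s' [[h1 h2] _ _]; rewrite !h1.
- by move=> e s' x v hx [h1 h2 h3]; split => //; apply: agree_nset.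
- by split.
- move=> i j s' im jn s6 s7 s8 [ha hb hc].
  have sW a : rarr s' 0 a = rarr s 0 a by case: ha => _ ->.
  have sp : rarr s' 4 0 = rarr s 4 0 by case: ha => _ ->.
  have s9 : narr s' 9 0 = r by case: ha => -> //.
  have s10 : narr s' 10 0 = c by case: ha => -> //.
  (* State between the two conditionals: the column copy already accounts for the current entry, the
     row copy does not yet. *)
  pose K (s1 : state R) :=
    [/\ narr s1 = narr s', agree [:: 6; 7; 8]%N [:: 1; 2]%N s s1,
      forall i', (i' < m)%N -> (i' * n + c < (i * n + j).+1)%N ->
        rarr s1 1 i' = W i' c / rarr s 4 0 &
      rarr s1 2 = rarr s' 2].
  apply: (@run_seq _ _ _ 2 2); apply: (@run_weaken _ _ 2 _ _ K) => //; last first.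
    apply: run_if => /=; rewrite s7 s10 -eqn_leq => jc.
      apply: run_rset; split => //=; first exact: agree_rset.
      move=> i' i'm; rewrite ltnS leq_eqVlt /store s6 s8 /=.
      case: (eqVneq i' i) => [-> _|ne /orP[/eqP|l]].
      + by rewrite sW sp (eqP jc).
      + by case/(row_major_inj cn jn) => e; rewrite e eqxx in ne.
      + exact: hb.
    apply: run_skip; split => // i' i'm; rewrite ltnS leq_eqVlt => /orP[/eqP|l].
      by case/(row_major_inj cn jn) => _ e; rewrite e eqxx in jc.
    exact: hb.
  move=> s1 [e1 a1 k1 k2].
  have sW1 a : rarr s1 0 a = rarr s 0 a by case: a1 => _ ->.
  apply: run_if => /=; rewrite e1 s6 s9 -eqn_leq => ir.
    apply: run_rset; split => /=; first by rewrite e1.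
    split => //=; first exact: agree_rset.
    move=> j' j'n; rewrite ltnS leq_eqVlt /store e1 s7 s8 k2 /=.
    case: (eqVneq j' j) => [-> _|ne /orP[/eqP|l]].
    + by rewrite sW1 (eqP ir).
    + by case/(row_major_inj j'n jn) => _ e; rewrite e eqxx in ne.
    + exact: hc.
  apply: run_skip; split => /=; first by rewrite e1.
  split => // j' j'n; rewrite ltnS leq_eqVlt k2 => /orP[/eqP|l].
    by case/(row_major_inj j'n jn) => e; rewrite e eqxx in ir.
  exact: hc.
- move=> s' [ha hb hc]; apply: hQ => // i hi.
    by apply: hb => //; apply: row_major_lt.
  by apply: hc => //; apply: row_major_lt.
Qed.

Definition update_step : program :=
  RSet 0 (nvar 8)
    (RSub (RGet 0 (nvar 8)) (RMul (RGet 1 (nvar 6)) (RGet 2 (nvar 7)))).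

Lemma run_update (R : realType) (m n : nat) (s : state R)
    (Q : state R -> Prop) :
  narr s 0 0 = m -> narr s 0 1 = n ->
  (forall s', agree [:: 6; 7; 8]%N [:: 0]%N s s' ->
     (forall i j, (i < m)%N -> (j < n)%N -> rarr s' 0 (i * n + j)%N =
        rarr s 0 (i * n + j)%N - rarr s 1 i * rarr s 2 j) -> Q s') ->
  run (sweep update_step) (m * (n * 4 + 4) + 3) s Q.
Proof.
move=> sm sn hQ; rewrite -{1}[4%N]/(1 + 3)%N.
(* Each entry is written only when visited, so the value read there is still the original one. *)
pose Inv e s' :=
  agree [:: 6; 7; 8]%N [:: 0]%N s s' /\
  forall i j, (i < m)%N -> (j < n)%N -> rarr s' 0 (i * n + j)%N =
    if (i * n + j < e)%N
    then rarr s 0 (i * n + j)%N - rarr s 1 i * rarr s 2 j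
    else rarr s 0 (i * n + j)%N.
apply: (@run_sweep _ m n _ _ Inv).
- by move=> e s' [[h1 h2] _]; rewrite !h1.
- by move=> e s' x v hx [h1 h2]; split => //; apply: agree_nset.
- by split.
- move=> i j s' im jn s6 s7 s8 [ha hb].
  have s1 a : rarr s' 1 a = rarr s 1 a by case: ha => _ ->.
  have s2 a : rarr s' 2 a = rarr s 2 a by case: ha => _ ->.
  apply: run_rset; split => //; split; first exact: agree_rset.
  move=> i' j' i'm j'n; rewrite /= /store s6 s7 s8 /= ltnS leq_eqVlt.
  case: eqVneq => /= [e|ne]; last by rewrite hb.
  have [-> ->] := row_major_inj j'n jn e.
  by rewrite hb // ltnn s1 s2.
- move=> s' [ha hb]; apply: hQ => // i j im jn.
  by rewrite hb // row_major_lt.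
Qed.

(** * Approximation invariant of the elimination *)

(* W is what is left of A after l pivots, at the positions (rs t, cs t) for
   t < l, and P is the product of their absolute values. *)
Definition eliminated (F : realFieldType) (m n k : nat) (A W : nat -> nat -> F)
    (l : nat) (rs cs : nat -> nat) (P : F) : Prop :=
  [/\ 0 <= P,
      forall q f g,
        (forall t, (t < l + q)%N -> (f t < m)%N) ->
        (forall t, (t < l + q)%N -> (g t < n)%N) ->
        (forall t, (t < l)%N -> f t = rs t) ->
        (forall t, (t < l)%N -> g t = cs t) ->
        P * `|\det (minor q W (f \o addn l) (g \o addn l))|
          <= `|\det (minor (l + q) A f g)| &
      forall M, minor_bound m n W (k - l) M ->
        minor_bound m n A k (k%:R ^+ 4 ^+ l * (P * M))].

Lemma eliminated0 (F : realFieldType) (m n k : nat) (A : nat -> nat -> F)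
    (rs cs : nat -> nat) : eliminated m n k A A 0 rs cs 1.
Proof. by split=> [|q f g _ _ _ _|M]; rewrite ?mul1r ?subn0 ?expr0 ?mul1r. Qed.

Lemma eq_minor (F : Type) (m n q : nat) (W W' : nat -> nat -> F)
    (f g : nat -> nat) :
  (forall i j, (i < m)%N -> (j < n)%N -> W i j = W' i j) ->
  (forall t, (t < q)%N -> (f t < m)%N) ->
  (forall t, (t < q)%N -> (g t < n)%N) ->
  minor q W f g = minor q W' f g.
Proof. by move=> h hf hg; apply/matrixP=> i j; rewrite !mxE h ?hf ?hg. Qed.

(** Replaces the factors depending on the order by a uniform k^4, so that the losses multiply to a
    plain power. *)
Lemma minor_bound_step (F : realFieldType) (m n : nat) (W : nat -> nat -> F)
    (r c q k : nat) (M : F) :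
  (r < m)%N -> (c < n)%N -> (q < k)%N ->
  (forall i j, (i < m)%N -> (j < n)%N -> `|W i j| <= `|W r c|) ->
  minor_bound m n (pivot W r c) q M ->
  minor_bound m n W q.+1 (k%:R ^+ 4 * (`|W r c| * M)).
Proof.
move=> rm cn qk hW hM.
have hM' := hM (fun=> r) (fun=> c) (fun _ _ => rm) (fun _ _ => cn).
have k1 : 1 <= k%:R ^+ 4 :> F by rewrite -natrX ler1n expn_gt0; case: k qk.
(* Order 1 needs the exact bound: the general factor would be 4, which exceeds k^4 when k = 1. *)
case: q qk hM hM' => [|q] qk hM hM' f g hf hg.
  apply: le_trans (minor_bound_pivot0 hW hf hg) _.
  rewrite det_mx00 normr1 in hM'.
  by rewrite mulrCA ler_peMr // mulr_ege1.
apply: le_trans (minor_bound_pivot rm cn hW hM hf hg) _.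
apply: ler_wpM2r; first by rewrite mulr_ge0 // (le_trans _ hM').
rewrite -natrX ler_nat.
have -> : (k ^ 4 = (k * k) * (k * k))%N by rewrite !expnS expn0; lia.
(* Here k >= q+2 >= 2, and 2 (q+2) (q+3) <= 4 (q+2)^2. *)
have h1 : (4 <= k * k)%N by nia.
have h2 : (q.+2 * q.+2 <= k * k)%N by apply: leq_mul.
by apply: leq_trans (leq_mul h1 h2); nia.
Qed.

(** The lower bound holds because a minor of order q+1 whose first indices are the new pivot equals
    the pivot times a minor of W'. The upper bound chains [minor_bound_step] with the bound already
    held for W. *)
Lemma eliminated_step (F : realFieldType) (m n k : nat)
    (A W W' : nat -> nat -> F) (l : nat) (rs cs rs' cs' : nat -> nat) (P : F) :
  (l < k)%N -> (rs' l < m)%N -> (cs' l < n)%N ->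
  (forall t, (t < l)%N -> rs' t = rs t) ->
  (forall t, (t < l)%N -> cs' t = cs t) ->
  (forall i j, (i < m)%N -> (j < n)%N -> `|W i j| <= `|W (rs' l) (cs' l)|) ->
  (forall i j, (i < m)%N -> (j < n)%N -> W' i j = pivot W (rs' l) (cs' l) i j) ->
  eliminated m n k A W l rs cs P ->
  eliminated m n k A W' l.+1 rs' cs' (P * `|W (rs' l) (cs' l)|).
Proof.
set r := rs' l; set c := cs' l => lk rm cn hrs hcs hmax hW' [P0 hlow hup].
split; first by rewrite mulr_ge0.
  move=> q f g hf hg fr gc.
  (* After a zero pivot the product is 0 and the lower bound is trivial. *)
  have [p0|p0] := eqVneq (W r c) 0; first by rewrite p0 normr0 mulr0 mul0r.
  have fl : f l = r by rewrite fr.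
  have gl : g l = c by rewrite gc.
  rewrite (@eq_minor _ m n _ _ (pivot W r c)) //; last 2 first.
  - by move=> t tq /=; apply: hf; lia.
  - by move=> t tq /=; apply: hg; lia.
  rewrite addSnnS in hf hg *.
  have := hlow _ _ _ hf hg _ _; rewrite det_minor_pivot /= addn0 fl gl //.
  rewrite normrM mulrA => h.
  have -> : minor q (pivot W r c) (f \o addn l.+1) (g \o addn l.+1) =
    minor q (pivot W r c) (f \o addn l \o succn) (g \o addn l \o succn).
    by apply/matrixP=> i j; rewrite !mxE /= !addnS.
  by apply: h => t tl; rewrite ?fr ?gc ?hrs ?hcs // ltnW.
move=> M hM; rewrite exprSr -mulrA.
have hM' : minor_bound m n (pivot W r c) (k - l.+1) M.
  move=> f g hf hg; rewrite -(@eq_minor _ m n _ W') //.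
  exact: hM.
have := minor_bound_step rm cn _ hmax hM'; move=> /(_ k ltac:(lia)).
have -> : (k - l.+1).+1 = (k - l)%N by lia.
move=> /hup h f g hf hg; apply: le_trans (h f g hf hg) _.
by rewrite le_eqVlt; apply/orP; left; apply/eqP; ring.
Qed.

(** * Bookkeeping of used rows and columns *)

Definition marked (m l : nat) (rs flag : nat -> nat) : Prop :=
  [/\ uniq (mkseq rs l), all (ltn^~ m) (mkseq rs l) &
      forall i, (flag i != 0%N) = (i \in mkseq rs l)].

(** Pigeonhole: fewer than m listed indices cannot exhaust all m. *)
Lemma marked_free (m l : nat) (rs flag : nat -> nat) :
  (l < m)%N -> marked m l rs flag -> exists2 i, (i < m)%N & flag i = 0%N.
Proof.
move=> lm [_ _ hf]; apply: contrapT => h.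
have : (size (iota 0 m) <= size (mkseq rs l))%N.
  apply: uniq_leq_size (iota_uniq _ _) _ => i; rewrite mem_iota -hf => im.
  by apply/eqP => f0; apply: h; exists i.
by rewrite size_iota size_mkseq leqNgt lm.
Qed.

Lemma marked_step (m l r : nat) (rs rs' flag flag' : nat -> nat) :
  marked m l rs flag -> (r < m)%N -> flag r = 0%N ->
  (forall t, rs' t = if t == l then r else rs t) ->
  (forall i, flag' i = if i == r then 1%N else flag i) ->
  marked m l.+1 rs' flag'.
Proof.
move=> [hu ha hf] rm fr hrs hfl; rewrite /marked mkseqS hrs eqxx.
have -> : mkseq rs' l = mkseq rs l.
  apply/eq_in_map => t; rewrite mem_iota hrs => tl.
  by case: eqVneq => // e; lia.
split; first by rewrite rcons_uniq hu -hf fr.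
  by rewrite all_rcons /= rm.
by move=> i; rewrite mem_rcons inE hfl -hf; case: (eqVneq i r).
Qed.

(** * The whole program and its invariant *)

Definition pivot_step : program :=
  Seq search
 (Seq (sweep copy_step)
 (Seq (sweep update_step)
 (Seq (NSet 1 (nvar 5) (nvar 9))
 (Seq (NSet 2 (nvar 5) (nvar 10))
 (Seq (NSet 3 (nvar 9) (NLit 1))
      (NSet 4 (nvar 10) (NLit 1))))))).

Definition complete_pivoting : program :=
  for_loop 5 (NGet 0 (NLit 2)) pivot_step.

(** Flagged rows and columns of [W] are zero. Searching among free entries therefore still finds a
    global maximum, while the indices found stay distinct even once [W] vanishes. *)
Definition pivoting_inv (R : realType) (m n k : nat) (A : nat -> nat -> R)
    (l : nat) (s : state R) : Prop :=
  let W i j := rarr s 0 (i * n + j)%N in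
  [/\ [/\ narr s 0 0 = m, narr s 0 1 = n & narr s 0 2 = k],
      marked m l (narr s 1) (narr s 3), marked n l (narr s 2) (narr s 4),
      forall i j, (i < m)%N -> (j < n)%N ->
        (narr s 3 i != 0%N) || (narr s 4 j != 0%N) -> W i j = 0 &
      exists P, eliminated m n k A W l (narr s 1) (narr s 2) P].

Lemma run_pivot_step (R : realType) (m n k l : nat) (A : nat -> nat -> R)
    (s : state R) :
  (k <= minn m n)%N -> (l < k)%N -> narr s 5 0 = l ->
  pivoting_inv m n k A l s ->
  run pivot_step (19 * (m * n) + 12 * m + 14) s
    (fun s' => narr s' 5 0 = l /\ pivoting_inv m n k A l.+1 s').
Proof.
rewrite leq_min => /andP[km kn] lk s5.
move=> [[s00 s01 s02] mr mc hz [P hP]].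
pose W i j := rarr s 0 (i * n + j)%N.
apply: (@run_leq _ _ ((m * (n * 8 + 4) + 4) + ((m * (n * 7 + 4) + 3) +
  ((m * (n * 4 + 4) + 3) + (1 + (1 + (1 + 1))))))%N); first by lia.
apply: run_seq; apply: (run_search s00 s01).
  have [i im i0] := marked_free (leq_trans lk km) mr.
  have [j jn j0] := marked_free (leq_trans lk kn) mc.
  by exists i, j; rewrite im jn i0 j0.
move=> s1 r c [a1n a1r] s1r s1c /and4P[rm cn /eqP fr /eqP fc] s1p hmax.
have hmax' i j : (i < m)%N -> (j < n)%N -> `|W i j| <= `|W r c|.
  move=> im jn; case: (boolP ((narr s 3 i != 0%N) || (narr s 4 j != 0%N))).
    by move=> h; rewrite /W hz // normr0.
  by rewrite negb_or !negbK => /andP[i0 j0]; rewrite hmax // im jn i0 j0.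
apply: run_seq; apply: (run_copy (m := m) (n := n) (r := r) (c := c)) => //.
- by rewrite a1n.
- by rewrite a1n.
move=> s2 [a2n a2r] s2c s2r.
apply: run_seq; apply: (run_update (m := m) (n := n)) => //.
- by rewrite a2n // a1n.
- by rewrite a2n // a1n.
move=> s3 [a3n a3r] s3W.
have eqn x a : x \notin [:: 6; 7; 8; 9; 10]%N -> narr s3 x a = narr s x a.
  move=> hx; have hx' : x \notin [:: 6; 7; 8]%N.
    by move: hx; rewrite !inE !negb_or => /and5P[-> -> ->].
  by rewrite a3n // a2n // a1n.
have e9 : narr s3 9 0 = r by rewrite a3n // a2n.
have e10 : narr s3 10 0 = c by rewrite a3n // a2n.
have WE i j : (i < m)%N -> (j < n)%N ->
    rarr s3 0 (i * n + j)%N = pivot W r c i j.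
  by move=> im jn; rewrite s3W // s2c // s2r // s1p a2r // !(a1r 0%N).
apply: run_seq; apply: run_nset; apply: run_seq; apply: run_nset.
apply: run_seq; apply: run_nset; apply: run_nset.
rewrite /= /store /= e9 e10 eqn // s5.
split; first by [].
split => /=.
- by rewrite /store /= !eqn.
- by apply: (marked_step mr rm fr) => t; rewrite /store /= eqn.
- by apply: (marked_step mc cn fc) => t; rewrite /store /= eqn.
- move=> i j im jn; rewrite /store /= !eqn // WE // /pivot => h.
  (* A zero pivot means that [W] is already zero. Otherwise the new row and column cancel, and in an
     old flagged row or column both terms of [pivot] vanish. *)
  have [p0|p0] := eqVneq (W r c) 0.
    have z i' j' : (i' < m)%N -> (j' < n)%N -> W i' j' = 0.
      by move=> *; apply/eqP; rewrite -normr_le0 -(normr0 R) -p0 hmax'.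
    by rewrite !z // mulr0 subr0.
  case: (eqVneq i r) h => [-> _|_]; first by rewrite divff // mul1r subrr.
  case: (eqVneq j c) => [-> _|_]; first by rewrite divfK // subrr.
  rewrite /W; case/orP => h; first by rewrite !(hz i) ?h // !mul0r subr0.
  by rewrite !(hz _ j) ?h ?orbT // mulr0 subr0.
- exists (P * `|W r c|).
  set rs' := (X in eliminated _ _ _ _ _ _ X).
  set cs' := (X in eliminated _ _ _ _ _ _ _ X).
  have rl : rs' l = r by rewrite /rs' /= /store /= eqxx.
  have cl : cs' l = c by rewrite /cs' /= /store /= eqxx.
  have -> : W r c = W (rs' l) (cs' l) by rewrite rl cl.
  apply: (eliminated_step lk _ _ _ _ _ _ hP); rewrite ?rl ?cl //.
  + by move=> t tl; rewrite /rs' /= /store /= ltn_eqF // eqn.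
  + by move=> t tl; rewrite /cs' /= /store /= ltn_eqF // eqn.
Qed.

Lemma run_complete_pivoting (R : realType) (m n k : nat) (s : state R)
    (Q : state R -> Prop) :
  let A i j := rarr s 0 (i * n + j)%N in
  (k <= minn m n)%N ->
  narr s 0 0 = m -> narr s 0 1 = n -> narr s 0 2 = k ->
  (forall i, narr s 3 i = 0%N) -> (forall j, narr s 4 j = 0%N) ->
  (forall s', pivoting_inv m n k A k s' -> Q s') ->
  run complete_pivoting (k * (19 * (m * n) + 12 * m + 14 + 2) + 2) s Q.
Proof.
move=> A kmn s00 s01 s02 s3 s4 hQ.
apply: (@run_for _ _ _ _ k _ (pivoting_inv m n k A)) => //.
- by move=> i s' [[]].
- split => //=.
  + by split => // i; rewrite /= /store /= s3.
  + by split => // i; rewrite /= /store /= s4.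
  + by move=> i j _ _; rewrite /store /= s3 s4.
  + by exists 1; apply: eliminated0.
- move=> l s' lk s5 hI.
  by apply: run_weaken (run_pivot_step kmn lk s5 hI) => // s1 [h1 h2].
Qed.

(** * Reading the input matrix and the output index sets *)

Lemma nth_allpairs (S T U : Type) (a : S) (b : T) (z : U) (h : S -> T -> U)
    (s : seq S) (t : seq T) (i j : nat) :
  (i < size s)%N -> (j < size t)%N ->
  nth z [seq h x y | x <- s, y <- t] (i * size t + j) = h (nth a s i) (nth b t j).
Proof.
move=> hi hj; elim: s i hi => [|x s IH] [|i] //= hi; rewrite nth_cat size_map.
  by rewrite mul0n add0n hj (nth_map b).
by rewrite mulSn -addnA ltnNge leq_addr /= addKn IH.
Qed.

Lemma input_entry (R : realType) (m n k : nat) (A : 'M[R]_(m, n))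
    (i : 'I_m) (j : 'I_n) :
  rarr (input k A) 0 (i * n + j)%N = A i j.
Proof.
have -> : (i * n + j = i * size (enum 'I_n) + j)%N by rewrite size_enum_ord.
by rewrite /= (nth_allpairs i j) ?size_enum_ord // !nth_ord_enum.
Qed.

Definition set_elt (m k : nat) (I : ksubset m k) : nat -> nat :=
  nth 0%N [seq val i | i <- enum (val I)].

Lemma set_eltE (m k : nat) (I : ksubset m k) (i : 'I_k) :
  set_elt I i = kelt I i.
Proof.
have hi : (i < size (enum (val I)))%N by rewrite -cardE (eqP (valP I)).
rewrite /set_elt (nth_map (kelt I i)) //; congr val.
by rewrite [RHS](enum_val_nth (kelt I i)).
Qed.

Lemma set_elt_lt (m k : nat) (I : ksubset m k) (t : nat) :
  (t < k)%N -> (set_elt I t < m)%N.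
Proof. by move=> tk; rewrite (set_eltE I (Ordinal tk)). Qed.

Lemma submatrix_minor (R : realType) (m n k : nat) (A : 'M[R]_(m, n))
    (I : ksubset m k) (J : ksubset n k) :
  submatrix A I J =
  minor k (fun i j => rarr (input k A) 0 (i * n + j)%N) (set_elt I) (set_elt J).
Proof.
by apply/matrixP=> i j; rewrite !mxE !set_eltE input_entry.
Qed.

Lemma ksubset_of_uniq (m k : nat) (f : nat -> nat) :
  uniq (mkseq f k) -> all (ltn^~ m) (mkseq f k) ->
  exists I : ksubset m k,
    perm_eq (mkseq f k) [seq val i | i <- enum (val I)].
Proof.
move=> hu /allP ha; pose S := [set i : 'I_m | val i \in mkseq f k].
have hp : perm_eq (mkseq f k) [seq val i | i <- enum S].
  apply: uniq_perm => //; first by rewrite map_inj_uniq ?enum_uniq //; apply: val_inj.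
  move=> x; apply/idP/mapP => [hx|[i + ->]]; last by rewrite mem_enum inE.
  by exists (Ordinal (ha _ hx)) => //; rewrite mem_enum inE.
have hS : #|S| == k by rewrite cardE -(size_map val) -(perm_size hp) size_mkseq.
by exists (exist _ S hS).
Qed.

(** Pivots are listed in the order found, [set_elt] in increasing order; the permutation between
    them can change only the sign of a determinant. *)
Lemma set_elt_perm (m k : nat) (I : ksubset m k) (f : nat -> nat) :
  perm_eq (mkseq f k) [seq val i | i <- enum (val I)] ->
  exists p : 'S_k, forall i : 'I_k, f i = set_elt I (p i).
Proof.
move=> hp.
have hs : size [seq val i | i <- enum (val I)] == k.
  by rewrite -(perm_size hp) size_mkseq.
have [p hpE] := @tuple_permP _ k (mkseq f k) (Tuple hs) hp.
exists p => i; have := congr1 (nth 0%N ^~ i) hpE.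
rewrite nth_mkseq // => ->.
by rewrite -tnth_nth tnth_mktuple (tnth_nth 0%N).
Qed.

Lemma norm_det_minor_perm (F : realFieldType) (k : nat) (W : nat -> nat -> F)
    (f f' g g' : nat -> nat) (p q : 'S_k) :
  (forall i : 'I_k, f i = f' (p i)) -> (forall j : 'I_k, g j = g' (q j)) ->
  `|\det (minor k W f g)| = `|\det (minor k W f' g')|.
Proof.
move=> hp hq.
have -> : minor k W f g = row_perm p (col_perm q (minor k W f' g')).
  by apply/matrixP=> i j; rewrite !mxE hp hq.
rewrite row_permE col_permE !det_mulmx !det_perm !normrM !normrX normrN1 !expr1n.
by rewrite mul1r mulr1.
Qed.

(* T bounds the running time as a polynomial in the number m * n of entries of
   the matrix (note that k <= m * n). *)
Theorem theorem1p1 (R : realType) :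
  exists (C : R) (alg : program) (T : {poly nat}),
    0 < C /\
    forall (m n k : nat) (A : 'M[R]_(m, n)),
      (1 <= k)%N -> (k <= minn m n)%N ->
      exists (t : nat) (s : state R) (I : ksubset m k) (J : ksubset n k),
        [/\ exec alg (input k A) t s,
            (t <= T.[(m * n)%N])%N,
            outputs s 1 I,
            outputs s 2 J &
            maxdet k A <=
              (k%:R `^ (C * k%:R)) * `|\det (submatrix A I J)| ].
Proof.
(* The exponent 4 k collects k losses of k^4. With N = m n and k, m <= N, the time k (19 N + 12 m +
   16) + 2 is at most (19 + 12 + 16 + 2) N^2. *)
exists 4, complete_pivoting, (49%N *: 'X^2); split=> // m n k A k1 kmn.
pose a i j := rarr (input k A) 0 (i * n + j)%N.
have [t [s [e te [_ [ur ar _] [uc ac _] _ [P [P0 hlow hup]]]]]] :=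
  @run_complete_pivoting R m n k (input k A) _ kmn erefl erefl erefl
    (fun=> erefl) (fun=> erefl) (fun _ => id).
have [I pI] := ksubset_of_uniq ur ar.
have [J pJ] := ksubset_of_uniq uc ac.
exists t, s, I, J; split => //.
  apply: leq_trans te _; rewrite hornerZ hornerXn.
  move: kmn; rewrite leq_min => /andP[km kn].
  have [mN kN] : (m <= m * n)%N /\ (k <= m * n)%N by nia.
  have -> : ((49%N * (m * n)%N ^+ 2)%R = 49 * ((m * n) * (m * n)))%N by [].
  by move: (m * n)%N mN kN => N mN kN; nia.
have [p hp] := set_elt_perm pI.
have [q hq] := set_elt_perm pJ.
have hin f l b : all (ltn^~ b) (mkseq f l) -> forall t, (t < l)%N -> (f t < b)%N.
  by move=> /allP h u ul; apply: h; apply/mapP; exists u; rewrite ?mem_iota.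
(* The lower bound with q = 0: the remaining minor is empty and has determinant 1. *)
have PD : P <= `|\det (submatrix A I J)|.
  rewrite submatrix_minor -(norm_det_minor_perm _ hp hq).
  have := hlow 0%N (narr s 1) (narr s 2); rewrite addn0 det_mx00 normr1 mulr1.
  by apply => //; apply: hin.
(* After k pivots only empty minors are left, so M = 1 starts the upper bound. *)
have b0 : minor_bound m n (fun i j => rarr s 0 (i * n + j)%N) (k - k) 1.
  by rewrite subnn => f g _ _; rewrite det_mx00 normr1.
have -> : (4 * k%:R : R) = (4 * k)%:R by rewrite natrM.
rewrite powR_mulrn // exprM; apply: bigmax_le.
  by rewrite mulr_ge0 // !exprn_ge0.
move=> [I' J'] _ /=; rewrite submatrix_minor.
apply: le_trans (hup _ b0 _ _ (set_elt_lt I') (set_elt_lt J')) _.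
by rewrite mulr1 ler_wpM2l // !exprn_ge0.
Qed.
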